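(* Let $m,n$ be positive integers with $n$ even and $m\le n$, and let $A=(a_{i,j})$ be any $m\times n$ matrix with all entries $a_{i,j}\in\{+1,-1\}$. Then there exist $x\in\{\pm1\}^n$ and $y\in\{\pm1\}^m$ such that $$\Big|\sum_{i=1}^m\sum_{j=1}^n y_i\,a_{i,j}\,x_j\Big|\le 2 .$$ That is, $|yAx|\le 2$ (with $y$ a row vector and $x$ a column vector): there exist row and column switches that reduce the imbalance of the board $A$ to at most $2$.
   Context: An $m\times n$ board of lights is represented by a matrix $A=(a_{i,j})$ with entries $\pm1$, where $a_{i,j}=1$ means the light in row $i$, column $j$ is on and $a_{i,j}=-1$ means it is off. Each row and each column has a switch that flips all lights in that row or column; $x_j=-1$ (resp. $y_i=-1$) means the switch of column $j$ (resp. row $i$) is thrown once, and $+1$ means it is not thrown. The imbalance of a board is the absolute difference between the number of lights on and the number of lights off. *)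

(* Defs.v *)
From mathcomp Require Import all_boot all_order all_algebra.

Set Implicit Arguments.
Unset Strict Implicit.
Unset Printing Implicit Defensive.

Import Order.TTheory GRing.Theory Num.Theory.

Local Open Scope ring_scope.

Definition pm1_mx (m n : nat) (A : 'M[int]_(m, n)) : Prop :=
  forall i j, A i j = 1 \/ A i j = -1.

(* y 0 i = -1 means that the switch of row i is thrown, and x j 0 = -1 that
   the switch of column j is thrown; each thrown switch changes the sign of
   every entry of its line. *)
Definition switched (m n : nat) (y : 'rV[int]_m) (x : 'cV[int]_n)
    (A : 'M[int]_(m, n)) : 'M[int]_(m, n) :=
  \matrix_(i, j) (y 0 i * A i j * x j 0).

(* Entry 1 is a light that is on, entry -1 a light that is off. *)
Definition lights_on (m n : nat) (A : 'M[int]_(m, n)) : {set 'I_m * 'I_n} :=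
  [set p | A p.1 p.2 == 1].

Definition lights_off (m n : nat) (A : 'M[int]_(m, n)) : {set 'I_m * 'I_n} :=
  [set p | A p.1 p.2 == -1].

Definition imbalance (m n : nat) (A : 'M[int]_(m, n)) : int :=
  `|#|lights_on A|%:Z - #|lights_off A|%:Z|.

(* Main.v *)
Require Import Defs.
From mathcomp Require Import all_boot all_order all_algebra.
From mathcomp Require Import zify ring lra.

Set Implicit Arguments.
Unset Strict Implicit.
Unset Printing Implicit Defensive.

Import Order.TTheory GRing.Theory Num.Theory.

Local Open Scope ring_scope.

(** Write [r i] for the row sums [(A *m x) i 0].  As [n] is even they are all
    even, [r i = 2 * b i], so it suffices to choose [x] in such a way that some
    signs [y] bring the sum of the [y i * b i] down to absolute value at most
    [1].  This is possible as soon as the rows can be listed so that each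
    [`|b i|] is at most one more than the sum of the previous ones: choose the
    signs from the last row to the first, each time pulling the partial sum
    towards [0] ([signs_balance]).

    Small row sums come from a floating-variable argument in the manner of
    Beck and Fiala.  Start from the zero vector and move inside the cube
    [[-1, 1]^n]; a coordinate that reaches [1] or [-1] is frozen.  As long as
    more than [k] coordinates are free, [k] row sums can be kept equal to [0]
    during the motion.  Giving up the rows one by one, the last of the list
    first, bounds the row of index [k] (counted from [0]) by
    [2 * (k + 1)], strictly, because it is still [0] when only [k + 1]
    coordinates are free.  Moreover each motion runs along a line and its
    direction can be reversed, so that a given linear form never decreases;
    with the right form this bounds every row sum by the number of rows [m]
    ([balanced_columns]).

    The missing ingredient is that the values [b i] which start the list should
    not vanish.  Here parity enters: the difference of two row sums modulo [4]
    does not depend on the signs [x], so the rows split into two classes in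
    which all row sums agree modulo [4].  One of them, [C], has at least
    [m / 2] rows and is put first.  If some row of [C] has sum [0], flip one
    coordinate of [x]: every row sum changes by [2] or [-2], so that all rows of
    [C] now have sum [2] modulo [4] ([balanced_switches_nonzero]).  Then
    [1 <= `|b i| <= k + 1] for the row of index [k] in [C], while the other rows
    satisfy [`|b i| <= m / 2 + 1 <= #|C| + 1]; this is the condition of
    [signs_balance]. *)

(** * Choosing signs greedily *)

(** The starting value [t] is what makes the induction work: the last element
    [c] of the list is absorbed into it, with the sign that brings [t] closer
    to [0], and the new value is again bounded by one plus the sum of the
    remaining elements. *)
Lemma signs_balance (I : eqType) (b : I -> int) (s : seq I) :
  uniq s ->
  (forall i, i \in s ->
     `|b i| <= 1 + \sum_(j <- take (index i s) s) `|b j|) ->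
  forall t : int, `|t| <= 1 + \sum_(j <- s) `|b j| ->
  exists y : I -> int, (forall i, y i = 1 \/ y i = -1) /\
    `|t + \sum_(i <- s) y i * b i| <= 1.
Proof.
elim/last_ind: s => [|s c IHs].
  move=> _ _ t; rewrite !big_nil addr0 => t_le1; exists (fun=> 1); split; first by left.
  by rewrite big_nil addr0.
rewrite rcons_uniq => /andP[cNs s_uniq] b_le t.
rewrite -cats1 big_cat big_seq1 /= => t_le.
have bc_le : `|b c| <= 1 + \sum_(j <- s) `|b j|.
  have := b_le c; rewrite mem_rcons mem_head -cats1 index_cat (negPf cNs) /= eqxx addn0.
  by rewrite take_size_cat // => /(_ isT).
(* With the wrong sign `|t + b c| may be too large, but then t and b c have the
   same sign and `|t - b c| is the distance between their absolute values. *)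
have [e [e_pm1 te_le]] : exists e : int,
    (e = 1 \/ e = -1) /\ `|t + e * b c| <= 1 + \sum_(j <- s) `|b j|.
  move: (\sum_(j <- s) _) bc_le t_le => S bc_le t_le.
  have [le_tb|lt_tb] := lerP `|t + b c| (1 + S).
    by exists 1; split; [left | rewrite mul1r].
  exists (-1); split; first by right.
  by rewrite mulN1r; move: (b c) bc_le t_le lt_tb => bc; lia.
have {}b_le i : i \in s -> `|b i| <= 1 + \sum_(j <- take (index i s) s) `|b j|.
  move=> i_s; have := b_le i; rewrite mem_rcons inE i_s orbT -cats1 index_cat i_s.
  by rewrite takel_cat ?index_size // => /(_ isT).
have [y [y_pm1 y_le]] := IHs s_uniq b_le _ te_le.
exists (fun i => if i == c then e else y i); split=> [i|]; first by case: eqP.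
rewrite big_cat big_seq1 /= eqxx [X in t + X]addrC addrA.
rewrite (eq_big_seq (fun i => y i * b i)) // => i i_s.
by case: eqP => // i_c; rewrite -i_c i_s in cNs.
Qed.

(** * Rounding a point of the cube *)

Lemma kernel_supported (F : fieldType) (p n : nat) (B : 'M[F]_(p, n))
    (J : {set 'I_n}) : (p < #|J|)%N ->
  exists2 v : 'cV[F]_n, v != 0 & B *m v = 0 /\ forall j, j \notin J -> v j 0 = 0.
Proof.
move=> lt_pJ.
(* Extension of vectors indexed by J by zero. *)
pose E : 'M[F]_(n, #|J|) := \matrix_(j, k) (enum_val k == j)%:R.
have /matrix0Pn[k0 [k1 K_neq0]] : kermx (B *m E)^T != 0.
  by rewrite kermx_eq0 -row_leq_rank -ltnNge (leq_ltn_trans (rank_leq_col _)).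
pose w := (row k0 (kermx (B *m E)^T))^T.
have Ew k : (E *m w) (enum_val k) 0 = w k 0.
  rewrite mxE (bigD1 k) //= big1 ?addr0 => [|l l_neqk]; first by rewrite !mxE eqxx mul1r.
  by rewrite !mxE (inj_eq enum_val_inj) (negPf l_neqk) mul0r.
exists (E *m w); last split.
- by apply/matrix0Pn; exists (enum_val k1), 0; rewrite Ew 2!mxE.
- by rewrite mulmxA -[LHS]trmxK trmx_mul trmxK -row_mul mulmx_ker row0 trmx0.
- move=> j jNJ; rewrite mxE big1 // => k _; rewrite mxE.
  by case: eqP => [jE|_]; rewrite ?mul0r //; rewrite -jE enum_valP in jNJ.
Qed.

Definition in_cube (F : realFieldType) (n : nat) (x : 'cV[F]_n) : Prop :=
  forall j, `|x j 0| <= 1.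

Definition floating (F : realFieldType) (n : nat) (x : 'cV[F]_n) : {set 'I_n} :=
  [set j | `|x j 0| < 1].

(** The points of the cube that can still be reached from [x] once its
    coordinates equal to [1] or [-1] are frozen. *)
Definition completes (F : realFieldType) (n : nat) (x z : 'cV[F]_n) : Prop :=
  in_cube z /\ forall j, j \notin floating x -> z j 0 = x j 0.

(** Follow the ray from [x] in direction [v] until it leaves the cube: at the
    exit point one more coordinate is frozen. *)
Lemma floating_step (F : realFieldType) (n : nat) (x v : 'cV[F]_n) :
  in_cube x -> v != 0 -> (forall j, j \notin floating x -> v j 0 = 0) ->
  exists2 t, 0 <= t &
    completes x (x + t *: v) /\ floating (x + t *: v) \proper floating x.
Proof.
move=> x_cube /matrix0Pn[j1 [k1]]; rewrite ord1 => {k1} v_neq0 v_supp.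
(* The time at which coordinate j reaches the boundary of the cube. *)
pose T j := (1 - Num.sg (v j 0) * x j 0) / `|v j 0|.
case: (@arg_minP _ _ _ j1 (fun j => v j 0 != 0) T v_neq0) => j0 vj0_neq0 T_min.
have x_bnd j : -1 <= x j 0 <= 1 by rewrite -ler_norml.
have hit : `|x j0 0 + T j0 * v j0 0| = 1.
  rewrite /T; case: (ltrgt0P (v j0 0)) vj0_neq0 => // vj0 _.
    by rewrite gtr0_sg // mulfVK ?gt_eqF // mul1r subrKC normr1.
  rewrite ltr0_sg // invrN mulrN mulNr mulfVK ?lt_eqF //.
  by rewrite mulN1r opprK opprD addrCA subrr addr0 normrN1.
have T_ge0 : 0 <= T j0.
  apply: divr_ge0 => //; have /andP[? ?] := x_bnd j0.
  by case: sgrP => _; rewrite ?mul0r ?mul1r ?mulN1r ?opprK; lra.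
exists (T j0) => //.
have eqx j : (x + T j0 *: v) j 0 = x j 0 + T j0 * v j 0 by rewrite !mxE.
split; first split.
- move=> j; rewrite eqx; have [->|vj_neq0] := eqVneq (v j 0) 0.
    by rewrite mulr0 addr0.
  have := T_min j vj_neq0; rewrite [T j]/T ler_pdivlMr ?normr_gt0 //.
  have /andP[lo hi] := x_bnd j; rewrite ler_norml.
  case: (ltrgt0P (v j 0)) vj_neq0 => // vj _.
    rewrite gtr0_sg // mul1r => ?; have := mulr_ge0 T_ge0 (ltW vj); lra.
  rewrite ltr0_sg // mulN1r opprK mulrN => ?.
  by have := mulr_ge0_le0 T_ge0 (ltW vj); lra.
- by move=> j jNf; rewrite eqx v_supp // mulr0 addr0.
- apply/properP; split.
    apply/subsetP => j; apply: contraLR => jNf; rewrite !inE eqx v_supp //.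
    by move: jNf; rewrite inE mulr0 addr0.
  exists j0; first by apply: contraR vj0_neq0 => /v_supp ->.
  by rewrite inE eqx hit ltxx.
Qed.

Lemma completes_trans (F : realFieldType) (n : nat) (x y z : 'cV[F]_n) :
  completes x y -> completes y z -> completes x z.
Proof.
move=> [_ xy] [z_cube yz]; split=> // j jNx.
rewrite yz ?xy // inE xy //; by rewrite inE in jNx.
Qed.

(** While there are more free coordinates than rows in [s], these rows have a
    common kernel vector supported on the free coordinates.  Moving along it
    leaves the row sums unchanged, and of the two directions one does not
    decrease the linear form [u]. *)
Lemma reduce_floating (F : realFieldType) (m n : nat) (A : 'M[F]_(m, n))
    (u : 'rV[F]_n) (s : seq 'I_m) (x : 'cV[F]_n) : in_cube x ->
  exists2 z, completes x z /\ (#|floating z| <= size s)%N &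
    {in s, forall i, (A *m z) i 0 = (A *m x) i 0} /\
    (u *m x) 0 0 <= (u *m z) 0 0.
Proof.
elim/(@ltn_ind): #|floating x| {-2}x (erefl #|floating x|) => k IHk {}x x_k x_cube.
have [le_ks|lt_sk] := leqP k (size s).
  by exists x => //; rewrite x_k; do ?split.
rewrite -{1}x_k in lt_sk.
have [v0 v0_neq0 [Bv0 v0_supp]] :=
  kernel_supported (rowsub (tnth (in_tuple s)) A) lt_sk.
pose v := (if 0 <= (u *m v0) 0 0 then 1 else -1) *: v0.
have v_neq0 : v != 0.
  by rewrite scaler_eq0 negb_or v0_neq0 andbT; case: ifP; rewrite ?oppr_eq0 oner_eq0.
have v_supp j : j \notin floating x -> v j 0 = 0.
  by move=> /v0_supp v0j; rewrite mxE v0j mulr0.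
have uv_ge0 : 0 <= (u *m v) 0 0.
  rewrite -scalemxAr mxE; case: ifPn => [|]; first by rewrite mul1r.
  by rewrite -ltNge mulN1r oppr_ge0 => /ltW.
have Av i : i \in s -> (A *m v) i 0 = 0.
  move=> i_s; have lt_is : (index i s < size s)%N by rewrite index_mem.
  pose l : 'I_(size s) := Ordinal lt_is.
  have -> : i = tnth (in_tuple s) l by rewrite (tnth_nth i) /= nth_index.
  have := congr1 (fun M : 'cV_ _ => M l 0) Bv0.
  rewrite mul_rowsub_mx mxE [RHS]mxE => Av0l.
  by rewrite -scalemxAr mxE Av0l mulr0.
have [t t_ge0 [x_z fl_lt]] := floating_step x_cube v_neq0 v_supp.
have lt_zk : (#|floating (x + t *: v)| < k)%N by rewrite -x_k proper_card.
have [z [z_z z_s] [Az uz]] := IHk _ lt_zk _ erefl x_z.1.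
exists z; first by split=> //; apply: completes_trans z_z.
split=> [i i_s|]; first by rewrite Az // mulmxDr -scalemxAr mxE [X in _ + X]mxE Av // mulr0 addr0.
apply: le_trans uz; rewrite mulmxDr -scalemxAr [leRHS]mxE lerDl mxE.
exact: mulr_ge0.
Qed.

Lemma row_deviation (F : realFieldType) (m n : nat) (A : 'M[F]_(m, n))
    (x z : 'cV[F]_n) (i : 'I_m) : (forall k j, `|A k j| <= 1) ->
  `|(A *m z) i 0 - (A *m x) i 0| <= \sum_j `|z j 0 - x j 0|.
Proof.
move=> A_le1; rewrite !mxE -sumrB.
apply: le_trans (ler_norm_sum _ _ _) _; apply: ler_sum => j _.
by rewrite -mulrBr normrM ler_piMl.
Qed.

(** Strictness comes from the fact that a free coordinate lies in the open
    interval, hence moves by less than [2]. *)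
Lemma completes_deviation (F : realFieldType) (n k : nat) (x z : 'cV[F]_n) :
  completes x z -> (#|floating x| <= k)%N -> (0 < k)%N ->
  \sum_j `|z j 0 - x j 0| < 2 * k%:R.
Proof.
move=> [z_cube zx] le_fk k_gt0.
rewrite (bigID (mem (floating x))) /= [X in _ + X]big1 ?addr0 => [|j jNf]; last first.
  by rewrite zx // subrr normr0.
have [f0|f_gt0] := set_0Vmem (floating x).
  by rewrite f0 big_set0 mulr_gt0 ?ltr0n.
apply: (@lt_le_trans _ _ (\sum_(j in floating x) 2)); last first.
  by rewrite sumr_const -[leLHS]mulr_natr ler_pM2l ?ler_nat.
have [j j_f] := f_gt0; apply: ltr_sum => [|{j_f}j].
  by apply/hasP; exists j; rewrite ?mem_index_enum.
rewrite inE => xj_lt1; apply: le_lt_trans (ler_normB _ _) _.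
by have := z_cube j; lra.
Qed.

(** The rows of [s] are given up one at a time, starting with the last one.  The
    row of index [k] still has sum [0] when at most [k + 1] coordinates are
    free, and whatever happens to these afterwards changes its sum by less than
    [2 * (k + 1)]. *)
Lemma rounding (F : realFieldType) (m n : nat) (A : 'M[F]_(m, n))
    (u : 'rV[F]_n) (s : seq 'I_m) (x : 'cV[F]_n) :
  (forall i j, `|A i j| <= 1) -> uniq s -> in_cube x ->
  (#|floating x| <= size s)%N -> {in s, forall i, (A *m x) i 0 = 0} ->
  exists2 z, completes x z /\ floating z = set0 &
    {in s, forall i, `|(A *m z) i 0| < 2 * (index i s).+1%:R} /\
    (u *m x) 0 0 <= (u *m z) 0 0.
Proof.
move=> A_le1; elim/last_ind: s x => [|s i0 IHs] x s_uniq x_cube x_s Ax.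
  exists x; first by split=> //; apply/eqP; rewrite -cards_eq0 -leqn0.
  by split=> // i; rewrite in_nil.
move: s_uniq; rewrite rcons_uniq => /andP[i0Ns s_uniq].
have [y [x_y y_s] [Ay uxy]] := reduce_floating A u s x_cube.
have Ay0 : {in s, forall i, (A *m y) i 0 = 0}.
  by move=> i i_s; rewrite Ay // Ax // mem_rcons inE i_s orbT.
have [z [y_z z_f] [Az uyz]] := IHs y s_uniq x_y.1 y_s Ay0.
have x_z := completes_trans x_y y_z.
exists z; first by split.
split=> [i|]; last exact: le_trans uyz.
rewrite mem_rcons inE -cats1 index_cat => /predU1P[->|i_s]; last by rewrite i_s Az.
rewrite (negPf i0Ns) /= eqxx addn0.
rewrite -[_ i0 0]subr0 -(Ax i0) ?mem_rcons ?mem_head //.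
apply: le_lt_trans (row_deviation _ _ _ A_le1) _.
by apply: completes_deviation x_z _ _; rewrite // -(size_rcons s i0).
Qed.

(** The first bound is [rounding].  For the second one, first move from [0] to a
    point [u] with [A *m u = 0] and at most [m] free coordinates, and round [u]
    to a sign vector [z] without decreasing the form [x |-> u^T *m x].  Since
    [`|z j - u j| = 1 - u j * z j], the total displacement is at most the sum
    of the [1 - u j ^ 2], to which only the free coordinates contribute, each
    at most [1]. *)
Lemma balanced_columns (F : realFieldType) (m n : nat) (A : 'M[F]_(m, n))
    (s : seq 'I_m) :
  (forall i j, `|A i j| <= 1) -> uniq s -> (forall i, i \in s) ->
  exists2 z : 'cV[F]_n, forall j, `|z j 0| = 1 &
    forall i, `|(A *m z) i 0| < 2 * (index i s).+1%:R /\
              `|(A *m z) i 0| <= m%:R.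
Proof.
move=> A_le1 s_uniq s_all.
have size_s : size s = m.
  by rewrite -(card_uniqP s_uniq) -[RHS]card_ord; apply: eq_card => i; rewrite s_all.
have [|u [u_cube u_s] [Au _]] := reduce_floating A 0 s (x := 0).
  by move=> j; rewrite mxE normr0 ler01.
have Au0 : {in s, forall i, (A *m u) i 0 = 0}.
  by move=> i i_s; rewrite Au // mulmx0 mxE.
have [z [u_z z_f] [Az uz]] := rounding u^T A_le1 s_uniq u_cube.1 u_s Au0.
have z_pm1 j : `|z j 0| = 1.
  apply/eqP; rewrite eq_le u_z.1 /= leNgt; apply/negP => zj_lt1.
  by have := in_set0 j; rewrite -z_f inE zj_lt1.
exists z => // i; split; first exact: Az.
rewrite -[_ i 0]subr0 -(Au0 i) //.
apply: le_trans (row_deviation _ _ _ A_le1) _.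
have dev j : `|z j 0 - u j 0| = 1 - u j 0 * z j 0.
  have := u_cube.1 j; rewrite ler_norml => /andP[? ?].
  have := z_pm1 j; case: (ger0P (z j 0)) => _ zE.
    by rewrite zE ger0_norm; lra.
  by have -> : z j 0 = -1; [lra | rewrite ler0_norm; lra].
rewrite (eq_bigr _ (fun j _ => dev j)).
apply: (@le_trans _ _ (\sum_j (1 - u j 0 * u j 0))).
  rewrite !sumrB lerB //; move: uz; rewrite !mxE.
  by under eq_bigr do rewrite mxE; under [leRHS]eq_bigr do rewrite mxE.
apply: (@le_trans _ _ #|floating u|%:R); last by rewrite ler_nat -size_s.
rewrite (bigID (mem (floating u))) /= [X in _ + X]big1 ?addr0 => [|j].
  rewrite -sum1_card natr_sum; apply: ler_sum => j _.
  by rewrite gerBl -expr2 sqr_ge0.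
rewrite inE -leNgt => uj_ge1.
have /eqP : `|u j 0| = 1 by apply/eqP; rewrite eq_le u_cube.1.
by rewrite -expr2 eqr_norml => /andP[/orP[]/eqP-> _]; rewrite ?sqrrN expr1n subrr.
Qed.

(** * Row sums of a board *)

Lemma balanced_switches (m n : nat) (A : 'M[int]_(m, n)) (s : seq 'I_m) :
  pm1_mx A -> uniq s -> (forall i, i \in s) ->
  exists2 x : 'cV[int]_n, pm1_mx x &
    forall i, `|(A *m x) i 0| < 2 * (index i s).+1%:Z /\
              `|(A *m x) i 0| <= m%:Z.
Proof.
move=> A_pm1 s_uniq s_all.
have AQ_le1 i j : `|map_mx intr A i j| <= 1 :> rat.
  by rewrite mxE -intr_norm; case: (A_pm1 i j) => ->.
have [z z_pm1 z_bnd] := balanced_columns AQ_le1 s_uniq s_all.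
pose x : 'cV[int]_n := \col_j (if z j 0 == 1 then 1 else -1).
have zE : z = map_mx intr x.
  apply/matrixP => j k; rewrite ord1 !mxE; have := z_pm1 j.
  case: eqP => [-> //|zN1] /eqP; rewrite eqr_norml => /andP[/orP[]/eqP // -> _].
exists x => [j k|i]; first by rewrite mxE; case: ifP; [left | right].
have := z_bnd i; rewrite zE -map_mxM mxE -intr_norm.
by rewrite -[2 * _]/(2%:~R * (index i s).+1%:Z%:~R) -intrM ltr_int -[m%:R]/(m%:Z%:~R) ler_int.
Qed.

(** The difference is the sum of the products
    [(A i j - A k j) * (x j - x' j)] of two even numbers. *)
Lemma row_difference_mod4 (m n : nat) (A : 'M[int]_(m, n)) (x x' : 'cV[int]_n)
    (i k : 'I_m) : pm1_mx A -> pm1_mx x -> pm1_mx x' ->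
  (4 %| (((A *m x) i 0 - (A *m x) k 0) - ((A *m x') i 0 - (A *m x') k 0))%R)%Z.
Proof.
move=> A_pm1 x_pm1 x'_pm1; rewrite !mxE -!sumrB; apply: rpred_sum => j _.
case: (A_pm1 i j) => ->; case: (A_pm1 k j) => ->;
  by case: (x_pm1 j 0) => ->; case: (x'_pm1 j 0) => ->.
Qed.

Lemma row_even (m n : nat) (A : 'M[int]_(m, n)) (x : 'cV[int]_n) (i : 'I_m) :
  ~~ odd n -> pm1_mx A -> pm1_mx x -> (2 %| (A *m x) i 0%R)%Z.
Proof.
move=> n_even A_pm1 x_pm1; rewrite mxE.
have -> : \sum_j A i j * x j 0 = \sum_j (A i j * x j 0 - 1) + n%:Z.
  by rewrite sumrB sumr_const card_ord -natz subrK.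
apply: rpredD; last by rewrite [_ \in _]dvdzE dvdn2.
apply: rpred_sum => j _.
by case: (A_pm1 i j) => ->; case: (x_pm1 j 0) => ->.
Qed.

Lemma sum_norm_ge_size (I : eqType) (b : I -> int) (s : seq I) :
  {in s, forall i, b i != 0} -> (size s)%:Z <= \sum_(i <- s) `|b i|.
Proof.
elim: s => [|i s IHs] b_neq0; first by rewrite big_nil.
rewrite big_cons /= -addn1 PoszD addrC lerD //.
  by have := b_neq0 i; rewrite mem_head => /(_ isT); lia.
by apply: IHs => k k_s; apply: b_neq0; rewrite inE k_s orbT.
Qed.

Definition congruent_rows (m n : nat) (A : 'M[int]_(m, n)) (C : {set 'I_m}) :=
  forall x : 'cV[int]_n, pm1_mx x ->
  {in C &, forall i k, (4 %| ((A *m x) i 0 - (A *m x) k 0)%R)%Z}.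

(** The classes are read off at the all-ones vector, where each row sum is [0]
    or [2] modulo [4]; by [row_difference_mod4] they serve for every [x]. *)
Lemma half_rows_congruent (m n : nat) (A : 'M[int]_(m, n)) :
  ~~ odd n -> pm1_mx A ->
  exists2 C : {set 'I_m}, (m <= #|C|.*2)%N & congruent_rows A C.
Proof.
move=> n_even A_pm1; pose x1 : 'cV[int]_n := const_mx 1.
have x1_pm1 : pm1_mx x1 by left; rewrite mxE.
pose r i : int := (A *m x1) i 0.
have congr_r (C : {set 'I_m}) :
    {in C &, forall i k, (4 %| (r i - r k)%R)%Z} ->
    congruent_rows A C.
  move=> C4 x x_pm1 i k iC kC.
  have := row_difference_mod4 i k A_pm1 x_pm1 x1_pm1.
  have := C4 i k iC kC; rewrite /r; lia.
have r_even i : (2 %| r i)%Z by apply: row_even.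
pose C0 := [set i | (4 %| r i)%Z].
have [le_m|gt_m] := leqP m #|C0|.*2.
  by exists C0 => //; apply: congr_r => i k; rewrite !inE; apply: rpredB.
exists (~: C0).
  have := cardsC C0; rewrite card_ord.
  by move: #|C0| #|~: C0| gt_m => c c'; lia.
apply: congr_r => i k; rewrite !inE.
by move: (r i) (r k) (r_even i) (r_even k) => a b; lia.
Qed.

(** Either no row of [C] has sum [0], or one has, and then all row sums in [C]
    are divisible by [4] and flipping a single coordinate makes them all
    congruent to [2].  The flip costs at most [2] in each bound; in the
    first bound nothing is lost, because an even number less than [2 * (k + 1)]
    is at most [2 * k]. *)
Lemma balanced_switches_nonzero (m n : nat) (A : 'M[int]_(m, n)) (C : {set 'I_m})
    (s : seq 'I_m) :
  (0 < n)%N -> ~~ odd n -> pm1_mx A -> uniq s -> (forall i, i \in s) ->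
  congruent_rows A C ->
  exists2 x : 'cV[int]_n, pm1_mx x &
    (forall i, `|(A *m x) i 0| <= 2 * (index i s).+1%:Z /\
               `|(A *m x) i 0| <= m%:Z + 2) /\
    {in C, forall i, (A *m x) i 0 != 0}.
Proof.
move=> n_gt0 n_even A_pm1 s_uniq s_all C_mod4.
have [x x_pm1 x_bnd] := balanced_switches A_pm1 s_uniq s_all.
have [/exists_inP[i0 i0C /eqP x0]|] := boolP [exists i in C, (A *m x) i 0 == 0]; last first.
  rewrite negb_exists_in => /forall_inP Cx; exists x => //; split=> // i.
  by have := x_bnd i; lia.
pose j0 := Ordinal n_gt0.
pose x' : 'cV[int]_n := \col_j (if j == j0 then - x j 0 else x j 0).
have x'E i : (A *m x') i 0 = (A *m x) i 0 - 2 * (A i j0 * x j0 0).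
  rewrite !mxE (bigD1 j0) //= [in RHS](bigD1 j0) //= mxE eqxx.
  rewrite (eq_bigr (fun j => A i j * x j 0)) => [|j /negPf jN0]; last by rewrite mxE jN0.
  by ring.
have Ax_pm1 i : A i j0 * x j0 0 = 1 \/ A i j0 * x j0 0 = -1.
  by case: (A_pm1 i j0) => ->; case: (x_pm1 j0 0) => ->; [left|right|right|left].
exists x' => [j k|].
  rewrite mxE; case: ifP => _; last exact: x_pm1.
  by case: (x_pm1 j 0) => ->; [right | left].
split=> i; last first.
  move=> iC; have := C_mod4 x x_pm1 i i0 iC i0C; rewrite x0 subr0 x'E.
  by move: ((A *m x) i 0) => r; case: (Ax_pm1 i) => -> /dvdzP[q ->]; lia.
have := x_bnd i; have := row_even i n_even A_pm1 x_pm1; rewrite x'E.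
by move: ((A *m x) i 0) => r; case: (Ax_pm1 i) => -> /dvdzP[q ->]; lia.
Qed.

(** * Balancing the board *)

Lemma imbalanceE (m n : nat) (B : 'M[int]_(m, n)) :
  pm1_mx B -> imbalance B = `|\sum_(i < m) \sum_(j < n) B i j|.
Proof.
move=> B_pm1; rewrite /imbalance; congr `|_|.
have card_sum (S : {set 'I_m * 'I_n}) : #|S|%:Z = \sum_p (p \in S)%:R.
  by rewrite -sum1_card -natz natr_sum big_mkcond; apply: eq_bigr => p _; case: ifP.
rewrite !card_sum -sumrB pair_bigA /=; apply: eq_bigr => p _.
by rewrite !inE; case: (B_pm1 p.1 p.2) => ->.
Qed.

Theorem mainTheorem1 (m n : nat) (m_gt0 : (0 < m)%N) (n_gt0 : (0 < n)%N)
    (n_even : ~~ odd n) (le_mn : (m <= n)%N)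
    (A : 'M[int]_(m, n)) (A_pm1 : pm1_mx A) :
  exists (x : 'cV[int]_n) (y : 'rV[int]_m),
    [/\ pm1_mx x, pm1_mx y,
        `|\sum_(i < m) \sum_(j < n) y 0 i * A i j * x j 0| <= 2,
        `|(y *m A *m x) 0 0| <= 2
      & imbalance (switched y x A) <= 2].
Proof.
have [C le_mC C_mod4] := half_rows_congruent n_even A_pm1.
pose s := enum C ++ enum (~: C).
have s_all i : i \in s by rewrite mem_cat !mem_enum inE orbN.
have s_uniq : uniq s.
  rewrite cat_uniq !enum_uniq /= andbT; apply/hasPn => i.
  by rewrite /= !mem_enum inE.
have [x x_pm1 [x_bnd Cx_neq0]] :=
  balanced_switches_nonzero n_gt0 n_even A_pm1 s_uniq s_all C_mod4.
pose b i := ((A *m x) i 0%R %/ 2)%Z.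
have rE i : (A *m x) i 0 = 2 * b i.
  by rewrite mulrC divzK // row_even.
have Cb_neq0 : {in C, forall i, b i != 0}.
  by move=> i /Cx_neq0; rewrite rE mulf_eq0.
have b_le i : i \in s -> `|b i| <= 1 + \sum_(j <- take (index i s) s) `|b j|.
  move=> _; have [] := x_bnd i; rewrite rE normrM (@gtr0_norm _ 2) // ler_pM2l //.
  rewrite -add1n PoszD => b_idx b_m.
  (* In C the previous rows contribute at least 1 each; outside C, all rows of
     C come before row i. *)
  have [iC|iNC] := boolP (i \in C).
    have lt_iC : (index i (enum C) < size (enum C))%N by rewrite index_mem mem_enum.
    have idx_i : index i s = index i (enum C) by rewrite index_cat mem_enum iC.
    have /sum_norm_ge_size : {in take (index i s) s, forall k, b k != 0}.
      move=> k; rewrite idx_i takel_cat ?(ltnW lt_iC) // => /mem_take.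
      by rewrite mem_enum; apply: Cb_neq0.
    rewrite size_takel ?index_size // => le_idx.
    by apply: le_trans b_idx _; rewrite lerD2l.
  rewrite index_cat mem_enum (negPf iNC) take_cat ltnNge leq_addr /= big_cat /=.
  have /sum_norm_ge_size : {in enum C, forall k, b k != 0}.
    by move=> k; rewrite mem_enum; apply: Cb_neq0.
  rewrite -cardE => C_le.
  set S := \sum_(j <- take _ _) _; have S_ge0 : 0 <= S by apply: sumr_ge0.
  by move: (\sum_(j <- enum C) _) C_le (`|b i|) b_m => T C_le r b_m; lia.
have [|y [y_pm1 y_bal]] := signs_balance s_uniq b_le (t := 0).
  by rewrite normr0 addr_ge0 // sumr_ge0.
pose yv : 'rV[int]_m := \row_i y i.
have sumE : \sum_(i < m) \sum_(j < n) yv 0 i * A i j * x j 0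
            = 2 * \sum_(i <- s) y i * b i.
  rewrite [in RHS](perm_big (index_enum 'I_m)) /=; last first.
    by apply: uniq_perm; rewrite ?index_enum_uniq // => i; rewrite s_all mem_index_enum.
  rewrite mulr_sumr; apply: eq_bigr => i _.
  rewrite mulrCA -rE !mxE mulr_sumr; apply: eq_bigr => j _.
  by rewrite mulrA.
have sum_le2 : `|\sum_(i < m) \sum_(j < n) yv 0 i * A i j * x j 0| <= 2.
  rewrite add0r in y_bal.
  by rewrite sumE normrM (@gtr0_norm _ 2) // -[leRHS]mulr1 ler_pM2l.
have yv_pm1 : pm1_mx yv by move=> i j; rewrite mxE.
exists x, yv; split=> //.
  suff -> : (yv *m A *m x) 0 0 = \sum_(i < m) \sum_(j < n) yv 0 i * A i j * x j 0.
    by [].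
  rewrite -mulmxA mxE; apply: eq_bigr => i _.
  by rewrite [(A *m x) i 0]mxE mulr_sumr; apply: eq_bigr => j _; rewrite mulrA.
rewrite imbalanceE => [|i j]; last first.
  rewrite mxE; case: (yv_pm1 0 i) => ->; case: (A_pm1 i j) => ->;
    by case: (x_pm1 j 0) => ->; by [left | right].
by under eq_bigr do under eq_bigr do rewrite mxE.
Qed.
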